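(* Let $G=(V,E)$ be a finite, simple, connected, undirected, unweighted graph. For any two nodes $u,v\in V$, let $u=x_0\sim x_1\sim\cdots\sim x_k=v$ be a shortest path from $u$ to $v$ in $G$ (so $k=d_G(u,v)$, the graph distance), and define $p_\star:=\min_{0\le i\le k}p(x_i)$, the minimum along this path of the node-level resistance curvature $p(\cdot)$. Then the commute time between $u$ and $v$ satisfies $$\mathbf{CT}(u,v)\;\le\;4\,|E|\,k\,(1-p_\star).$$
   Context: $\mathcal N(x)$ denotes the set of neighbors of $x$. $R_{\mathrm{eff}}(x,y)$ denotes the effective resistance between $x$ and $y$ when every edge of $G$ is a unit resistor. The node-level resistance curvature of a vertex $x$ is $$p(x)=1-\frac12\sum_{y\in\mathcal N(x)}R_{\mathrm{eff}}(x,y).$$ The commute time $\mathbf{CT}(u,v)$ is the expected number of steps for the simple random walk on $G$ started at $u$ to reach $v$ and then return to $u$. *)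

(* Defs.v *)
From mathcomp Require Import all_boot all_order all_algebra.
From mathcomp Require Import all_classical all_reals all_analysis.

Set Implicit Arguments.
Unset Strict Implicit.
Unset Printing Implicit Defensive.

Import Order.TTheory GRing.Theory Num.Theory.

Local Open Scope ring_scope.

Section Graph.
Variables (T : finType) (e : rel T).

Definition simple_connected_graph : Prop :=
  [/\ symmetric e, irreflexive e & forall x y, connect e x y].

Definition edge_set : {set {set T}} :=
  [set [set p.1; p.2]%SET | p in [pred p : T * T | e p.1 p.2]]%SET.

(* As with [path], the walk is u :: s, so [size s] is its number of edges. *)
Definition shortest_path (u v : T) (s : seq T) : Prop :=
  [/\ path e u s, last u s = v &
      forall s', path e u s' -> last u s' = v -> (size s <= size s')%N].

Definition degree (x : T) : nat := #|e x|.

End Graph.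

Section Resistance.
Variables (R : realType) (T : finType) (e : rel T).

(* Node potentials when a unit current enters at x and leaves at y: by Ohm's
   law the edge (z, w) carries phi z - phi w, and Kirchhoff's current law
   holds at every node. *)
Definition unit_current_potential (x y : T) (phi : T -> R) : Prop :=
  forall z, \sum_(w | e z w) (phi z - phi w) = (z == x)%:R - (z == y)%:R.

(* The potential drop from x to y under a unit current. On a connected graph
   such potentials exist and differ by constants, so the set is a singleton
   and the default 0 is never used. *)
Definition effective_resistance (x y : T) : R :=
  xget 0 [set r | exists2 phi, unit_current_potential x y phi
                             & r = phi x - phi y]%classic.

Definition resistance_curvature (x : T) : R :=
  1 - 2^-1 * \sum_(y | e x y) effective_resistance x y.

Definition min_curvature (u : T) (s : seq T) : R :=
  \big[Order.min/resistance_curvature u]_(x <- s) resistance_curvature x.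

End Resistance.

Section RandomWalk.
Variables (R : realType) (T : finType) (e : rel T).

(* A walker at an isolated vertex stays there; in a connected graph this only
   concerns the one-vertex graph. *)
Definition step_prob (x y : T) : R :=
  if degree e x == 0%N then (x == y)%:R
  else if e x y then (degree e x)%:R^-1 else 0.

Context d (Omega : measurableType d) (P : probability Omega R).
Variable X : nat -> Omega -> T.

(* The third clause is P(X_{n+1} = x_{n+1} | X_0 = x_0, ..., X_n = x_n)
   = step_prob x_n x_{n+1}, multiplied out so that histories of probability 0
   need no special treatment. *)
Definition simple_random_walk (u : T) : Prop :=
  [/\ forall n a, measurable [set w | X n w = a]%classic,
      P [set w | X 0%N w = u]%classic = 1%E &
      forall (n : nat) (x : nat -> T),
        P [set w | forall i, (i <= n.+1)%N -> X i w = x i]%classic =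
        (P [set w | forall i, (i <= n)%N -> X i w = x i]%classic *
         (step_prob (x n) (x n.+1))%:E)%E].

(* The first time n at which the walk is at u having been at v at some time
   m <= n; it is +oo if there is none. *)
Definition return_time (u v : T) (w : Omega) : \bar R :=
  ereal_inf [set n%:R%:E | n in
    [set n : nat | X n w = u /\ exists2 m, (m <= n)%N & X m w = v]]%classic.

(* Meaningful when X is a simple random walk started at u. *)
Definition commute_time (u v : T) : \bar R :=
  (\int[P]_w return_time u v w)%E.

End RandomWalk.

(* Main.v *)
(* Let h_a(z) be the expected time to hit a from z. It solves
   L h_a = deg - 2|E| delta_a for the graph Laplacian L, so h_v - h_u is, up to
   an additive constant, 2|E| times the potential of a unit current from u to
   v, and CT(u,v) = h_v(u) + h_u(v) = 2|E| Reff(u,v). By the maximum principle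
   Reff is subadditive along the path, and each edge has
   Reff(x_i,x_{i+1}) <= sum_{y ~ x_i} Reff(x_i,y) = 2(1 - p(x_i)).

   Only the upper bound CT(u,v) <= h_v(u) + h_u(v) is needed. Writing tau for
   the return time, E[tau] = sum_n P(tau > n), and a cylinder set C that fixes
   X_0, ..., X_n satisfies sum_{k < N} P(C, tau > n + k) <= P(C) g, where g is
   the expected remaining time expressed through h_u and h_v: this follows by
   induction on N, splitting C according to X_{n+1}. *)
Require Import Defs.
From HB Require Import structures.
From mathcomp Require Import all_boot all_order all_algebra.
From mathcomp Require Import all_classical all_reals all_analysis.
From mathcomp Require Import measurable_realfun ring lra.

Set Implicit Arguments.
Unset Strict Implicit.
Unset Printing Implicit Defensive.

Import Order.TTheory GRing.Theory Num.Theory.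

Local Open Scope ring_scope.

(** * Potential theory of the graph Laplacian *)

Section Laplacian.
Variables (R : realType) (T : finType) (e : rel T).
Hypothesis he : simple_connected_graph e.

Definition laplacian (f : T -> R) (z : T) : R := \sum_(w | e z w) (f z - f w).

Lemma laplacianB (f g : T -> R) (z : T) :
  laplacian (fun x => f x - g x) z = laplacian f z - laplacian g z.
Proof. by rewrite /laplacian -sumrB; apply: eq_bigr => w _; ring. Qed.

Lemma laplacianD (f g : T -> R) (z : T) :
  laplacian (fun x => f x + g x) z = laplacian f z + laplacian g z.
Proof. by rewrite /laplacian -big_split; apply: eq_bigr => w _ /=; ring. Qed.

Lemma laplacianZ (c : R) (f : T -> R) (z : T) :
  laplacian (fun x => c * f x) z = c * laplacian f z.
Proof. by rewrite /laplacian mulr_sumr; apply: eq_bigr => w _; ring. Qed.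

Lemma laplacianN (f : T -> R) (z : T) :
  laplacian (fun x => - f x) z = - laplacian f z.
Proof. by rewrite /laplacian -sumrN; apply: eq_bigr => w _; ring. Qed.

Lemma laplacianE (f : T -> R) (z : T) :
  laplacian f z = (degree e z)%:R * f z - \sum_(w | e z w) f w.
Proof.
by rewrite /laplacian sumrB sumr_const mulr_natl.
Qed.

Lemma sum_laplacian (f : T -> R) : \sum_z laplacian f z = 0.
Proof.
have [esym _ _] := he.
have -> : \sum_z laplacian f z =
    \sum_z \sum_(w | e z w) f z - \sum_z \sum_(w | e z w) f w.
  by rewrite -sumrB; apply: eq_bigr => z _; rewrite -sumrB.
rewrite [X in _ - X](exchange_big_dep predT) //=.
under [X in _ - X]eq_bigr do under eq_bigl do rewrite esym.
by rewrite subrr.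
Qed.

(** At a maximum point other than [a] the Laplacian is a sum of nonnegative terms that is at most 0,
    so every neighbour is again a maximum point; connectedness carries this to [a]. *)
Lemma max_principle (f : T -> R) (a : T) :
  (forall z, z != a -> laplacian f z <= 0) -> forall z, f z <= f a.
Proof.
have [_ _ econn] := he.
move=> lf z.
have [m _ fmax] : {m | true & forall y, f y <= f m}.
  case: (@Order.TotalTheory.arg_maxP _ _ _ a xpredT f) => // m _ h.
  by exists m => // y; apply: h.
suff -> : f a = f m by exact: fmax.
have /connectP[p] := econn m a.
suff reach t : path e t p -> a = last t p -> f t = f m -> f a = f m.
  by move=> mp ap; apply: (reach m).
elim: p t => [|w p IHp] t /=; first by move=> _ ->.
case/andP=> etw pw lst ft.
have [<- //|ta] := eqVneq t a.
apply: (IHp w) => //; apply/eqP; rewrite -ft eq_sym -subr_eq0.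
have ge0 y : e t y -> 0 <= f t - f y by rewrite subr_ge0 ft.
have : laplacian f t == 0 by rewrite eq_le (lf _ ta) /= sumr_ge0.
rewrite /laplacian psumr_eq0 // => /allP/(_ w).
by rewrite mem_index_enum etw => /(_ isT).
Qed.

Lemma min_principle (f : T -> R) (a : T) :
  (forall z, z != a -> 0 <= laplacian f z) -> forall z, f a <= f z.
Proof.
move=> lf z; rewrite -lerN2; apply: (max_principle (f := fun x => - f x)) => y ya.
by rewrite laplacianN oppr_le0 lf.
Qed.

Lemma harmonic_const (f : T -> R) :
  (forall z, laplacian f z = 0) -> forall x y, f x = f y.
Proof.
by move=> lf x y; apply/eqP; rewrite eq_le !max_principle // => z _; rewrite lf.
Qed.

Lemma connected_degree_gt0 (x y : T) : x != y -> (0 < degree e x)%N.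
Proof.
have [_ _ econn] := he.
move=> xy; have /connectP[[/= _ /esym/eqP|w p /= /andP[exw _] _]] := econn x y.
  by rewrite (negPf xy).
by apply/card_gt0P; exists w.
Qed.

(* Adding the all-ones matrix makes the Laplacian invertible, and does not
   change it on functions of sum 0. *)
Definition shifted_laplacian (f : {ffun T -> R^o}) : {ffun T -> R^o} :=
  [ffun z => laplacian f z + \sum_w f w].

Fact shifted_laplacian_linear : linear shifted_laplacian.
Proof.
move=> a f g; apply/ffunP => z; rewrite !ffunE.
have -> : laplacian (a *: f + g) z = a * laplacian f z + laplacian g z.
  rewrite -laplacianZ -laplacianD /laplacian.
  by apply: eq_bigr => w _; rewrite !ffunE.
have -> : \sum_w (a *: f + g : {ffun T -> R^o}) w
          = a * (\sum_w f w) + \sum_w g w.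
  by rewrite mulr_sumr -big_split; apply: eq_bigr => w _; rewrite !ffunE.
by transitivity (a * (laplacian f z + \sum_w f w) +
  (laplacian g z + \sum_w g w)); [ring | by []].
Qed.

HB.instance Definition _ :=
  GRing.isLinear.Build R {ffun T -> R^o} {ffun T -> R^o} *:%R
    shifted_laplacian shifted_laplacian_linear.

Lemma sum_shifted_laplacian (f : {ffun T -> R^o}) :
  \sum_z shifted_laplacian f z = #|T|%:R * \sum_w f w.
Proof.
under eq_bigr do rewrite ffunE.
by rewrite big_split /= sum_laplacian add0r sumr_const mulr_natl.
Qed.

(** On a finite-dimensional space, injectivity of the shifted Laplacian gives a preimage [f] of [b].
    Since [#|T|] times the sum of [f] is the sum of [b], the shift vanishes on [f]. *)
Lemma poisson_solvable (b : T -> R) :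
  \sum_z b z = 0 -> exists f, forall z, laplacian f z = b z.
Proof.
move=> sb0; have [/card0_eq T0|/pred0Pn[x0 _]] := eqVneq #|T| 0%N.
  by exists (fun=> 0) => z; have := T0 z.
have T_neq0 : #|T|%:R != 0 :> R by rewrite pnatr_eq0; apply/pred0Pn; exists x0.
have sum0 f : \sum_z shifted_laplacian f z = 0 -> \sum_w f w = 0.
  by rewrite sum_shifted_laplacian => /eqP; rewrite mulf_eq0 (negPf T_neq0) /= => /eqP.
have ker0 : lker (linfun shifted_laplacian) == 0%VS.
  apply/lker0P => f g; rewrite !lfunE /= => fg; apply/eqP; rewrite -subr_eq0.
  have h0 : shifted_laplacian (f - g) = 0 by rewrite linearB /= fg subrr.
  move: (f - g) h0 => h h0.
  (* Summing the kernel equation over all nodes cancels the Laplacian, so [h] has sum 0; it is then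
     harmonic, hence constant, hence 0. *)
  have sh0 : \sum_w h w = 0.
    by apply: sum0; rewrite h0 big1 // => z _; rewrite ffunE.
  have hc : forall x y, h x = h y.
    apply: harmonic_const => z; have := congr1 (fun k : {ffun T -> R^o} => k z) h0.
    by rewrite !ffunE sh0 addr0.
  apply/eqP/ffunP => z; rewrite ffunE; apply/eqP; move/eqP: sh0.
  rewrite (eq_bigr (fun=> h z)) => [|w _]; last exact: hc.
  by rewrite sumr_const -mulr_natl mulf_eq0 (negPf T_neq0).
pose c : {ffun T -> R^o} := [ffun z => b z].
pose f := ((linfun shifted_laplacian)^-1)%VF c.
have fE : shifted_laplacian f = c.
  by rewrite -[LHS](lfunE shifted_laplacian) /= lker0_lfunVK.
exists f => z; have := congr1 (fun k : {ffun T -> R^o} => k z) fE.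
rewrite !ffunE sum0 ?addr0 // fE -[RHS]sb0.
by apply: eq_bigr => w _; rewrite ffunE.
Qed.

(** * Unit-current potentials and effective resistance *)

Lemma sum_delta (a : T) : \sum_z (z == a)%:R = 1 :> R.
Proof. by rewrite -natr_sum (bigD1 a) //= eqxx big1 ?addn0 // => i /negPf ->. Qed.

Lemma unit_current_potential_ex (x y : T) :
  exists phi : T -> R, unit_current_potential e x y phi.
Proof.
by apply: poisson_solvable; rewrite sumrB !sum_delta subrr.
Qed.

Lemma effective_resistanceE (x y : T) (phi : T -> R) :
  unit_current_potential e x y phi ->
  effective_resistance R e x y = phi x - phi y.
Proof.
move=> hphi; rewrite /effective_resistance.
(* The potential [phi] rules out the default value; any other potential [psi] differs from it by a
   harmonic function, hence a constant. *)
case: xgetP => [r _ [psi hpsi ->]|/(_ (phi x - phi y))]; last by case; exists phi.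
have diff0 z : laplacian (fun t => psi t - phi t) z = 0.
  by rewrite laplacianB [laplacian psi z]hpsi [laplacian phi z]hphi subrr.
by have := harmonic_const diff0 x y; lra.
Qed.

(** Current enters only at [x] and leaves only at [y], so [phi] is largest at [x] and smallest at
    [y]. *)
Lemma potential_drop_le (x y : T) (phi : T -> R) (a b : T) :
  unit_current_potential e x y phi ->
  phi a - phi b <= effective_resistance R e x y.
Proof.
move=> hphi; rewrite (effective_resistanceE hphi).
apply: lerB.
  apply: max_principle => z zx; rewrite [laplacian _ _]hphi (negPf zx) sub0r.
  by rewrite oppr_le0.
apply: min_principle => z zy; rewrite [laplacian _ _]hphi (negPf zy) subr0.
by [].
Qed.

Lemma effective_resistance_ge0 (x y : T) : 0 <= effective_resistance R e x y.
Proof.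
have [phi hphi] := unit_current_potential_ex x y.
by have := potential_drop_le x x hphi; rewrite subrr.
Qed.

(** Superposition: unit currents from [x] to [y] and from [y] to [z] add up to one from [x] to [z],
    and each summand drops between [x] and [z] by at most its own resistance. *)
Lemma effective_resistance_triangle (x y z : T) :
  effective_resistance R e x z <=
  effective_resistance R e x y + effective_resistance R e y z.
Proof.
have [phi hphi] := unit_current_potential_ex x y.
have [psi hpsi] := unit_current_potential_ex y z.
have hsum : unit_current_potential e x z (fun w => phi w + psi w).
  move=> w; rewrite -[LHS]/(laplacian (fun w => phi w + psi w) w) laplacianD.
  by rewrite [laplacian phi w]hphi [laplacian psi w]hpsi; ring.
rewrite (effective_resistanceE hsum).
have := potential_drop_le x z hphi.
have := potential_drop_le x z hpsi.
by lra.
Qed.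

Lemma effective_resistance_refl (x : T) : effective_resistance R e x x = 0.
Proof.
have [phi hphi] := unit_current_potential_ex x x.
by rewrite (effective_resistanceE hphi) subrr.
Qed.

Lemma effective_resistance_edge (x y : T) : e x y ->
  effective_resistance R e x y <= 2 * (1 - resistance_curvature R e x).
Proof.
move=> exy; rewrite /resistance_curvature (bigD1 y) //=.
have : 0 <= \sum_(i | e x i && (i != y)) effective_resistance R e x i.
  by apply: sumr_ge0 => i _; apply: effective_resistance_ge0.
by lra.
Qed.

Lemma effective_resistance_path (c : R) (x : T) (s : seq T) :
  path e x s -> (forall y, y \in x :: s -> c <= resistance_curvature R e y) ->
  effective_resistance R e x (last x s) <= (size s)%:R * (2 * (1 - c)).
Proof.
elim: s x => [|y s IHs] x /=; first by rewrite effective_resistance_refl mul0r.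
case/andP=> exy pys hc.
have := effective_resistance_triangle x y (last y s).
have := effective_resistance_edge exy.
have := hc x (mem_head _ _).
have hcs z : z \in y :: s -> c <= resistance_curvature R e z.
  by move=> zs; apply: hc; rewrite inE zs orbT.
have := IHs y pys hcs.
by rewrite -natr1 mulrDl mul1r; lra.
Qed.

Lemma min_curvature_le (u : T) (s : seq T) (y : T) : y \in u :: s ->
  min_curvature R e u s <= resistance_curvature R e y.
Proof.
rewrite /min_curvature inE => /predU1P[->|ys]; first exact: bigmin_le_id.
exact: bigmin_inf_seq ys _ (lexx _).
Qed.

(** * Hitting functions, the commute identity and the edge count *)

(** The prescribed Laplacian sums to 0, so the Poisson equation is solvable. It is a degree away
    from [a], so the solution shifted to vanish at [a] is nonnegative by the minimum principle. *)
Lemma hitting_function_ex (a : T) : exists h : T -> R,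
  [/\ h a = 0, forall z, 0 <= h z &
   forall z, laplacian h z = (degree e z)%:R
                             - (\sum_x degree e x)%:R * (z == a)%:R].
Proof.
have [|f hf] := poisson_solvable
    (b := fun z => (degree e z)%:R - (\sum_x degree e x)%:R * (z == a)%:R).
  by rewrite sumrB -mulr_sumr sum_delta mulr1 natr_sum subrr.
exists (fun z => f z - f a); split.
- by rewrite subrr.
- move=> z; rewrite subr_ge0; apply: min_principle => y ya.
  by rewrite hf (negPf ya) mulr0 subr0.
- by move=> z; rewrite -hf; apply: eq_bigr => w _; ring.
Qed.

Lemma step_prob_laplacian (h : T -> R) (z : T) : (0 < degree e z)%N ->
  \sum_y step_prob R e z y * h y = h z - laplacian h z / (degree e z)%:R.
Proof.
move=> dz; have dz0 : (degree e z)%:R != 0 :> R by rewrite pnatr_eq0 -lt0n.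
rewrite laplacianE mulrBl mulrAC divff // mul1r opprB addrC subrK.
rewrite mulr_suml [RHS]big_mkcond; apply: eq_bigr => y _.
rewrite /step_prob -[_ == 0%N]negbK -lt0n dz /=.
by case: ifP => _; rewrite ?mul0r // mulrC.
Qed.

Lemma sum_step_prob (z : T) : \sum_y step_prob R e z y = 1.
Proof.
rewrite /step_prob; have [dz|dz] := eqVneq (degree e z) 0%N.
  by rewrite (bigD1 z) //= eqxx big1 ?addr0 // => y; rewrite eq_sym => /negPf ->.
by rewrite -big_mkcond sumr_const -[LHS]mulr_natl divff // pnatr_eq0.
Qed.

Lemma hitting_functions_commute (u v : T) (hu hv : T -> R) :
  (forall z, laplacian hu z = (degree e z)%:R
                              - (\sum_x degree e x)%:R * (z == u)%:R) ->
  (forall z, laplacian hv z = (degree e z)%:R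
                              - (\sum_x degree e x)%:R * (z == v)%:R) ->
  hu u = 0 -> hv v = 0 ->
  hv u + hu v = (\sum_x degree e x)%:R * effective_resistance R e u v.
Proof.
move=> lu lv hu0 hv0.
have [phi hphi] := unit_current_potential_ex u v.
rewrite (effective_resistanceE hphi).
(* The degree terms of [hu] and [hv] cancel, and the remaining delta terms are those of the scaled
   potential. *)
have diff0 z : laplacian (fun t => (hv t - hu t) -
    (\sum_x degree e x)%:R * phi t) z = 0.
  by rewrite !laplacianB laplacianZ lu lv [laplacian phi z]hphi; ring.
by have := harmonic_const diff0 u v; rewrite hu0 hv0; lra.
Qed.

(** The degree sum counts ordered adjacent pairs; grouped by the edge they span, each fibre lies in
    [[set (a, b); (b, a)]]. *)
Lemma handshake_le : (\sum_x degree e x <= 2 * #|edge_set e|)%N.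
Proof.
have -> : (\sum_x degree e x = #|[pred p : T * T | e p.1 p.2]|)%N.
  rewrite -sum1_card -(pair_big_dep xpredT e (fun _ _ => 1%N)) /=.
  by apply: eq_bigr => x _; rewrite sum1_card.
rewrite -[leqLHS]sum1_card.
rewrite (partition_big_imset (fun p : T * T => [set p.1; p.2]%SET)) /= mulnC.
rewrite -[leqRHS]sum_nat_const; apply: leq_sum => _ /imsetP[[a b] _ ->] /=.
rewrite sum1_card; apply: (@leq_trans #|[set (a, b); (b, a)]%SET|); last first.
  by rewrite cards2; case: eqP.
apply: subset_leq_card; apply/fintype.subsetP => -[c d] /=.
rewrite !inE /= => /andP[_ /eqP/setP E].
have := E a; have := E b; have := E c; have := E d; rewrite !inE !eqxx !orbT /=.
rewrite !xpair_eqE (eq_sym d a) (eq_sym c a) (eq_sym d b) (eq_sym c b).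
by case: (eqVneq a c) (eqVneq a d) (eqVneq b c) (eqVneq b d) => [?|?] [?|?] [?|?] [?|?].
Qed.

End Laplacian.

(** * Commute time of the random walk *)

Section Returned.
Variables (T : finType) (u v : T).

Fixpoint visited (x : nat -> T) (n : nat) : bool :=
  if n is m.+1 then visited x m || (x n == v) else x 0%N == v.

(** A boolean recursion on time, suited to induction and one-step updates. When [u = v] the first
    visit already counts as the return, in agreement with [return_time]. *)
Fixpoint returned (x : nat -> T) (n : nat) : bool :=
  if n is m.+1 then returned x m || visited x n && (x n == u)
  else (x 0%N == v) && (x 0%N == u).

Lemma visitedP (x : nat -> T) (n : nat) :
  reflect (exists2 m, (m <= n)%N & x m = v) (visited x n).
Proof.
elim: n => [|n IHn] /=; first by apply: (iffP eqP) => [|[[]//]]; exists 0%N.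
apply: (iffP orP) => [[/IHn[m mn xm]|/eqP xn]|[m]].
- by exists m => //; apply: leqW.
- by exists n.+1.
- rewrite leq_eqVlt => /predU1P[-> ->|mn xm]; first by right.
  by left; apply/IHn; exists m.
Qed.

Lemma returnedP (x : nat -> T) (n : nat) :
  reflect (exists2 k, (k <= n)%N & x k = u /\ exists2 m, (m <= k)%N & x m = v)
          (returned x n).
Proof.
elim: n => [|n IHn].
  apply: (iffP andP) => [[/eqP xv /eqP xu]|[k]].
    by exists 0%N => //; split=> //; exists 0%N.
  rewrite leqn0 => /eqP-> [/eqP xu [m]].
  by rewrite leqn0 => /eqP-> /eqP xv.
apply: (iffP orP) => [[/IHn[k kn xk]|/andP[/visitedP vn /eqP un]]|[k]].
- by exists k => //; apply: leqW.
- by exists n.+1.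
- rewrite leq_eqVlt => /predU1P[-> [un /visitedP vn]|kn xk].
    by right; rewrite vn un eqxx.
  by left; apply/IHn; exists k.
Qed.

Lemma eq_visited (x y : nat -> T) (n : nat) :
  (forall i, (i <= n)%N -> x i = y i) -> visited x n = visited y n.
Proof.
elim: n => [|n IHn] xy /=; first by rewrite xy.
by rewrite IHn ?xy // => i ni; apply/xy/leqW.
Qed.

Lemma eq_returned (x y : nat -> T) (n : nat) :
  (forall i, (i <= n)%N -> x i = y i) -> returned x n = returned y n.
Proof.
elim: n => [|n IHn] xy /=; first by rewrite xy.
have xyn i : (i <= n)%N -> x i = y i by move=> ni; apply/xy/leqW.
by rewrite IHn // (eq_visited xyn) xy.
Qed.

Lemma returned_mono (x : nat -> T) (m n : nat) :
  (m <= n)%N -> returned x m -> returned x n.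
Proof.
move=> mn /returnedP[k km xk]; apply/returnedP; exists k => //.
exact: leq_trans km mn.
Qed.

(** Appends a candidate next state [y] to the prefix up to time [n]; cylinders are split by the next
    step in this way. *)
Definition extend (x : nat -> T) (n : nat) (y : T) (i : nat) : T :=
  if (i <= n)%N then x i else y.

Lemma extend_le (x : nat -> T) (n : nat) (y : T) (i : nat) :
  (i <= n)%N -> extend x n y i = x i.
Proof. by rewrite /extend => ->. Qed.

Lemma extendS (x : nat -> T) (n : nat) (y : T) : extend x n y n.+1 = y.
Proof. by rewrite /extend ltnn. Qed.

End Returned.

Section CommuteTime.
Variables (R : realType) (T : finType) (e : rel T).
Hypothesis he : simple_connected_graph e.
Variables (u v : T) (d : measure_display) (Omega : measurableType d).
Variables (P : probability Omega R) (X : nat -> Omega -> T).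
Hypothesis hX : simple_random_walk e P X u.

Local Open Scope classical_set_scope.

(** * Cylinder and tail events of the walk *)

Definition history (x : nat -> T) (n : nat) : set Omega :=
  [set w | forall i, (i <= n)%N -> X i w = x i].

Definition not_returned (n : nat) : set Omega :=
  [set w | ~~ returned u v (X^~ w) n].

Lemma measurable_state (n : nat) (a : T) : measurable [set w | X n w = a].
Proof. by case: hX. Qed.

Lemma historyS (x : nat -> T) (n : nat) :
  history x n.+1 = history x n `&` [set w | X n.+1 w = x n.+1].
Proof.
apply/seteqP; split=> w /= => [xw|[xw xn] i].
  by split=> [i ni|]; apply: xw => //; apply: leqW.
by rewrite leq_eqVlt => /predU1P[->//|/xw].
Qed.

Lemma measurable_history (x : nat -> T) (n : nat) : measurable (history x n).
Proof.
elim: n => [|n IHn]; last first.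
  by rewrite historyS; apply: measurableI => //; apply: measurable_state.
rewrite (_ : history x 0 = [set w | X 0%N w = x 0%N]).
  exact: measurable_state.
apply/seteqP; split=> w /= xw => [|i]; first exact: xw.
by rewrite leqn0 => /eqP->.
Qed.

Lemma measurable_visited (n : nat) : measurable [set w | visited v (X^~ w) n].
Proof.
elim: n => [|n IHn] /=.
  rewrite (_ : [set w | _] = [set w | X 0%N w = v]); first exact: measurable_state.
  by apply/seteqP; split=> w /= /eqP.
rewrite (_ : [set w | _] =
    [set w | visited v (X^~ w) n] `|` [set w | X n.+1 w = v]).
  by apply: measurableU => //; apply: measurable_state.
apply/seteqP; split=> w /=; first by case/orP=> [|/eqP]; [left|right].
by case=> [->//|->]; rewrite eqxx orbT.
Qed.

Lemma measurable_not_returned (n : nat) : measurable (not_returned n).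
Proof.
rewrite (_ : not_returned n = ~` [set w | returned u v (X^~ w) n]); last first.
  by apply/seteqP; split=> w /= /negP.
apply: measurableC; elim: n => [|n IHn].
  rewrite (_ : [set w | _] = [set w | X 0%N w = v] `&` [set w | X 0%N w = u]).
    by apply: measurableI; apply: measurable_state.
  apply/seteqP; split=> w /=; first by case/andP=> /eqP ? /eqP.
  by case=> -> ->; rewrite !eqxx.
rewrite (_ : [set w | _] = [set w | returned u v (X^~ w) n] `|`
    ([set w | visited v (X^~ w) n.+1] `&` [set w | X n.+1 w = u])).
  apply: measurableU => //; apply: measurableI; last exact: measurable_state.
  exact: measurable_visited.
apply/seteqP; split=> w.
  by rewrite /= => /orP[|/andP[? /eqP]]; [left|right].
by rewrite /= => -[->//|[-> ->]]; rewrite eqxx orbT.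
Qed.

Lemma prob_split (A : set Omega) (n : nat) : measurable A ->
  fine (P A) = \sum_y fine (P (A `&` [set w | X n w = y])).
Proof.
move=> mA; apply: EFin_inj; rewrite fineK ?fin_num_measure // -sumEFin.
have mF y : measurable (A `&` [set w | X n w = y]).
  by apply: measurableI => //; apply: measurable_state.
under eq_bigr do rewrite fineK ?fin_num_measure //.
rewrite fsbig_seq ?index_enum_uniq // -measure_fin_bigcup //.
- congr (P _); apply/seteqP; split=> [w Aw|w [y _ []//]].
  by exists (X n w) => //=; rewrite mem_index_enum.
- by move=> i j _ _ [w [[_ /= <-] [_ /= <-]]].
Qed.

Lemma prob_historyS (x : nat -> T) (n : nat) (y : T) :
  fine (P (history (extend x n y) n.+1)) =
  fine (P (history x n)) * step_prob R e (x n) y.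
Proof.
have [_ _ /(_ n (extend x n y))] := hX.
rewrite -/(history (extend x n y) n.+1) -/(history (extend x n y) n) => ->.
rewrite extendS extend_le // fineM ?fin_num_measure //=; last exact: measurable_history.
congr (fine (P _) * _); apply/seteqP.
by split=> w /= xw i ni; have := xw i ni; rewrite extend_le.
Qed.

(* [hu z] and [hv z] are the expected times to hit u and v from z. *)
Variables hu hv : T -> R.
Hypotheses (hu0 : hu u = 0) (hv0 : hv v = 0).
Hypotheses (hu_ge0 : forall z, 0 <= hu z) (hv_ge0 : forall z, 0 <= hv z).
Hypothesis hu_step :
  forall z, z != u -> \sum_y step_prob R e z y * hu y = hu z - 1.
Hypothesis hv_step :
  forall z, z != v -> \sum_y step_prob R e z y * hv y = hv z - 1.
Hypothesis sum_step_prob : forall z, \sum_y step_prob R e z y = 1.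

(** * One-step analysis of the remaining time *)

(** Before [v] is met, the walk must reach [v] and from there [u]; afterwards only [u] is left to
    reach. *)
Definition expected_remaining (x : nat -> T) (n : nat) : R :=
  if returned u v x n then 0
  else if visited v x n then hu (x n) else hv (x n) + hu v.

Lemma expected_remaining_ge0 (x : nat -> T) (n : nat) :
  0 <= expected_remaining x n.
Proof. by rewrite /expected_remaining; do 2!case: ifP => // _; rewrite addr_ge0. Qed.

(** In either phase the relevant hitting function loses 1 on average, and the phase changes are
    seamless because [hv v = 0] and [hu u = 0]. *)
Lemma expected_remaining_step (x : nat -> T) (n : nat) : ~~ returned u v x n ->
  \sum_y step_prob R e (x n) y * expected_remaining (extend x n y) n.+1 =
  expected_remaining x n - 1.
Proof.
move=> nret.
have ext_ret y : returned u v (extend x n y) n = false.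
  by rewrite (@eq_returned _ _ _ _ x) ?(negPf nret) // => i; apply: extend_le.
have ext_vis y : visited v (extend x n y) n = visited v x n.
  by apply: eq_visited => i; apply: extend_le.
rewrite /expected_remaining (negPf nret).
have [vis|nvis] := boolP (visited v x n).
  rewrite -hu_step; last first.
    apply: contraNneq nret => xu; apply/returnedP.
    by exists n => //; split=> //; apply/visitedP.
  apply: eq_bigr => y _ /=; rewrite ext_ret ext_vis vis extendS /=.
  by case: eqVneq => // ->; rewrite hu0.
have xv : x n != v.
  by apply: contraNneq nvis => xv; apply/visitedP; exists n.
(* The constant [hu v] is spread over the next states, whose probabilities sum to 1. *)
rewrite addrAC -hv_step // -[X in _ = _ + X]mul1r -(sum_step_prob (x n)).
rewrite mulr_suml -big_split.
apply: eq_bigr => y _ /=; rewrite ext_ret ext_vis (negPf nvis) extendS /= -mulrDr.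
congr (_ * _); have [->|yv] := eqVneq y v; last by [].
(* Stepping to [v] leaves [hu v], which is 0 if [u = v], when the return occurs at once. *)
by rewrite hv0 add0r; case: eqVneq => //= ->; rewrite hu0.
Qed.

Lemma sum_not_returned_history (N : nat) (x : nat -> T) (n : nat) :
  \sum_(k < N) fine (P (history x n `&` not_returned (n + k))) <=
  fine (P (history x n)) * expected_remaining x n.
Proof.
have mhn := measurableI _ _ (measurable_history _ _) (measurable_not_returned _).
elim: N x n => [|N IHN] x n.
  by rewrite big_ord0 mulr_ge0 ?fine_ge0 ?measure_ge0 ?expected_remaining_ge0.
have [ret|nret] := boolP (returned u v x n).
  rewrite big1 => [|k _].
    by rewrite mulr_ge0 ?fine_ge0 ?measure_ge0 ?expected_remaining_ge0.
  rewrite (_ : _ `&` _ = set0) ?measure0 //; apply/seteqP; split=> w //= [xw].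
  move=> /negP; apply; apply: (returned_mono (m := n)); first exact: leq_addr.
  by rewrite (@eq_returned _ _ _ _ x).
rewrite big_ord_recl.
have le0 : fine (P (history x n `&` not_returned (n + @ord0 N))) <=
           fine (P (history x n)).
  rewrite fine_le ?fin_num_measure //; first exact: measurable_history.
  apply: le_measure; rewrite ?inE //; first exact: measurable_history.
(* The 1 pays for the term [k = 0]; the average over next states pays for the terms [k >= 1], by
   induction on the extended histories. *)
have -> : expected_remaining x n =
  1 + \sum_y step_prob R e (x n) y * expected_remaining (extend x n y) n.+1.
  by rewrite expected_remaining_step // addrC subrK.
rewrite mulrDr mulr1; apply: lerD => //.
have split_step k : fine (P (history x n `&` not_returned (n + lift ord0 k))) =
    \sum_y fine (P (history (extend x n y) n.+1 `&` not_returned (n.+1 + k))).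
  rewrite (prob_split n.+1) //; apply: eq_bigr => y _; congr (fine (P _)).
  rewrite lift0 addnS -addSn setIAC historyS extendS; congr (_ `&` _ `&` _).
  by apply/seteqP; split=> w /= xw i ni; have := xw i ni; rewrite extend_le.
under eq_bigr do rewrite split_step.
rewrite exchange_big mulr_sumr /=; apply: ler_sum => y _.
by rewrite mulrA -prob_historyS; apply: IHN.
Qed.

Lemma sum_not_returned (N : nat) :
  \sum_(k < N) fine (P (not_returned k)) <= hv u + hu v.
Proof.
have [_ X0 _] := hX.
have hist0 : history (fun=> u) 0 = [set w | X 0%N w = u].
  apply/seteqP; split=> w /= xw => [|i]; first exact: xw.
  by rewrite leqn0 => /eqP->.
apply: (@le_trans _ _ (\sum_(k < N)
    fine (P (history (fun=> u) 0 `&` not_returned (0 + k))))).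
  (* Starting points other than [u] have probability 0, so only the cylinder [X 0 = u]
     contributes. *)
  apply: ler_sum => k _; rewrite add0n (prob_split 0 (measurable_not_returned k)).
  rewrite (bigD1 u) //= big1 ?addr0 => [|y yu].
    by rewrite hist0 setIC.
  rewrite (subset_measure0 (B := ~` [set w | X 0%N w = u])) //.
  - apply: measurableI; last exact: measurable_state.
    exact: measurable_not_returned.
  - by apply: measurableC; apply: measurable_state.
  - by move=> w /= [_ ->]; apply/eqP.
  - transitivity (1 - P [set w | X 0%N w = u])%E; last by rewrite X0 subee.
    by apply: probability_setC; apply: measurable_state.
apply: le_trans (sum_not_returned_history N _ _) _.
rewrite hist0 X0 mul1r /expected_remaining /=.
(* If [u = v] the return happens at time 0 and the expected remaining time is 0. *)
by case: eqVneq => [<-|_]; rewrite ?eqxx ?hu0 /= ?addr_ge0.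
Qed.

(** The indicator of [tau > k] is 1 exactly for [k] before the first return, so the series counts up
    to [tau]; without a return both sides are infinite. *)
Lemma return_time_series (w : Omega) :
  return_time R X u v w = (\sum_(k <oo) (\1_(not_returned k) w)%:E)%E.
Proof.
have exact_returned n : X n w = u /\ (exists2 m, (m <= n)%N & X m w = v) ->
    returned u v (X^~ w) n by move=> Xn; apply/returnedP; exists n.
have ind_ge0 k : (0 <= (\1_(not_returned k) w : R)%:E)%E by rewrite lee_fin.
have [[n0 ret0]|nret] := pselect (exists n, returned u v (X^~ w) n); last first.
  rewrite /return_time (_ : [set n | _] = set0); last first.
    apply/seteqP; split=> n //= Xn; apply: nret.
    by exists n; apply: exact_returned.
  rewrite image_set0 ereal_inf0; apply/esym/eqyP => A A_gt0.
  (* [Num.bound A] is an integer above [A], and that many terms equal to 1 already exceed [A]. *)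
  apply: le_trans (nneseries_lim_ge (Num.bound A) _); last first.
    by move=> *; apply: ind_ge0.
  rewrite (eq_bigr (fun=> 1%:E)) => [|k _]; last first.
    rewrite indicE mem_set //=; apply/negP => retk; apply: nret.
    by exists k.
  rewrite sumEFin sumr_const_nat subn0 lee_fin.
  by apply: ltW; apply: archi_boundP; apply: ltW.
case: (ex_minnP (ex_intro _ n0 ret0)) => N retN minN.
have ind_lt k : (\1_(not_returned k) w : R)%:E = (k < N)%:R%:E.
  rewrite indicE; congr (nat_of_bool _)%:R%:E; apply/idP/idP; rewrite inE /not_returned /=.
    by apply: contraR; rewrite -leqNgt => /returned_mono; apply.
  by rewrite ltnNge; apply: contra => /minN.
have -> : (\sum_(k <oo) (\1_(not_returned k) w)%:E = N%:R%:E :> \bar R)%E.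
  rewrite (nneseries_split 0 N) // add0n [X in (_ + X)%E]eseries0 ?adde0; last first.
    by move=> k Nk _; rewrite ind_lt ltnNge Nk.
  rewrite (eq_big_nat _ _ (F2 := fun=> 1%:E)) => [|k /andP[_ kN]]; last first.
    by rewrite ind_lt kN.
  by rewrite sumEFin sumr_const_nat subn0.
apply/le_anti/andP; split.
  apply: ereal_inf_lbound; exists N => //=.
  (* The return recorded by time [N] occurs at some [k <= N]; minimality of [N] forces [k = N]. *)
  have /returnedP[k kN Xk] := retN.
  have /minN Nk := exact_returned _ Xk.
  by have -> : N = k by apply/anti_leq; rewrite Nk.
apply: le_ereal_inf_tmp => _ [n /exact_returned/minN Nn <-].
by rewrite lee_fin ler_nat.
Qed.

(** The integral and the series of nonnegative indicators are exchanged, and [sum_not_returned]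
    bounds all partial sums uniformly. *)
Lemma commute_time_le : (commute_time P X u v <= (hv u + hu v)%:E)%E.
Proof.
rewrite /commute_time (eq_integral _ _ (fun w _ => return_time_series w)).
rewrite integral_nneseries //; last first.
  move=> k; apply/measurable_EFinP; apply: measurable_indic.
  exact: measurable_not_returned.
apply: lime_le.
  by apply: is_cvg_nneseries => k _ _; apply: integral_ge0 => w _; rewrite lee_fin.
apply: nearW => N; rewrite big_mkord.
rewrite (eq_bigr (fun k : 'I_N => (fine (P (not_returned k)))%:E)) => [|k _].
  by rewrite sumEFin lee_fin sum_not_returned.
have mk := measurable_not_returned k.
by rewrite integral_indic // setIT fineK // fin_num_measure.
Qed.

End CommuteTime.

Theorem theorem1 (R : realType) (T : finType) (e : rel T)
  (he : simple_connected_graph e)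
  (u v : T) (s : seq T) (hs : shortest_path e u v s)
  (d : measure_display) (Omega : measurableType d)
  (P : probability Omega R) (X : nat -> Omega -> T)
  (hX : simple_random_walk e P X u) :
  (commute_time P X u v <=
   (4 * #|edge_set e|%:R * (size s)%:R * (1 - min_curvature R e u s))%:E)%E.
Proof.
have [hu [hu0 hu_ge0 lu]] := hitting_function_ex R he u.
have [hv [hv0 hv_ge0 lv]] := hitting_function_ex R he v.
have sum_step z := sum_step_prob R e z.
(* Away from [a] the degree is positive by connectedness, so dividing the Laplacian equation by it
   gives the one-step equation. *)
have step a h : (forall z, laplacian e h z =
    (degree e z)%:R - (\sum_x degree e x)%:R * (z == a)%:R) ->
    forall z, z != a -> \sum_y step_prob R e z y * h y = h z - 1.
  move=> lh z za; have dz := connected_degree_gt0 he za.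
  rewrite step_prob_laplacian // lh (negPf za) mulr0 subr0 divff //.
  by rewrite pnatr_eq0 -lt0n.
apply: le_trans (commute_time_le hX hu0 hv0 hu_ge0 hv_ge0
  (step _ _ lu) (step _ _ lv) sum_step) _.
rewrite lee_fin (hitting_functions_commute he lu lv hu0 hv0).
have [pus lus _] := hs.
have := effective_resistance_path he pus (fun y => @min_curvature_le R T e u s y).
rewrite lus => Ruv.
have R_ge0 := effective_resistance_ge0 R he u v.
have deg_le : (\sum_x degree e x)%:R <= 2 * #|edge_set e|%:R :> R.
  by rewrite -natrM ler_nat handshake_le.
(* The constant 4 is the 2 of the handshake bound times the 2 of the edge resistance bound. *)
apply: le_trans (ler_wpM2r R_ge0 deg_le) _.
apply: le_trans (ler_wpM2l _ Ruv) _; first by rewrite mulr_ge0.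
by rewrite le_eqVlt; apply/orP; left; apply/eqP; ring.
Qed.
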